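(* (Classification of rings whose unit group is an elementary abelian $p$-group, $p$ odd.) Let $p$ be an odd prime. The following four statements hold. (1) Let $k$ be a field and let $R$ be a finite-dimensional commutative $k$-algebra. Then $R$ is a $\Delta_p$-ring if and only if $p$ is a Mersenne prime and $R\cong(\mathbb{F}_2)^a\times(\mathbb{F}_{p+1})^b$ for some nonnegative integers $a$ and $b$. (2) A finite commutative ring $R$ is a $\Delta_p$-ring if and only if $p$ is a Mersenne prime and $R\cong(\mathbb{F}_2)^a\times(\mathbb{F}_{p+1})^b$ for some nonnegative integers $a$ and $b$. (3) Let $n$ be a positive integer and let $G$ be an abelian group. Then the group ring $\mathbb{Z}_nG$ is a $\Delta_p$-ring if and only if $n=2$, $G$ is an elementary abelian $p$-group, and $p$ is some Mersenne prime. (4) Let $k$ be a field and let $Q$ be a finite acyclic quiver. Then the path algebra $kQ$ is a $\Delta_p$-ring if and only if $k=\mathbb{F}_2$ or $\mathbb{F}_{p+1}$ where $p$ is a Mersenne prime and $Q$ is trivial.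
   Context: All rings are associative with identity. For a prime $p$, a ring $R$ is called a $\Delta_p$-ring if every unit $u\in R^\times$ satisfies $u^p=1$; for commutative $R$ this is equivalent to $R^\times$ being an elementary abelian $p$-group. A Mersenne prime is a prime of the form $2^m-1$ for some integer $m$. $\mathbb{Z}_n$ denotes $\mathbb{Z}/n\mathbb{Z}$ and $\mathbb{F}_q$ the field with $q$ elements. An elementary abelian $p$-group is a direct sum of copies of the cyclic group $C_p$ of order $p$. A quiver $Q$ is a directed, not necessarily simple, graph; it is acyclic if it has no directed cycles, and trivial if it has no edges. The path algebra $kQ$ is the $k$-vector space with basis the directed paths in $Q$, including for each vertex $i$ a path $e_i$ of length $0$ at $i$. For two paths $a,b$, the product $ab$ is the concatenation ($b$ followed by $a$) if $b$ ends at the vertex where $a$ starts, and $0$ otherwise.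
   Formalization: The right-hand sides also allow the cases where the English fails: in (1),(2) R≅(F_2)^a for any odd prime p (e.g. p=5, R=F_2); in (3) n=2 with G trivial, or n=1; in (4) Q without vertices. In (4), ''p is a Mersenne prime'' is required only when k=F_{p+1}. *)

(* Defs.v *)
From HB Require Import structures.
From mathcomp Require Import all_boot all_order all_algebra all_field.
From mathcomp Require Import finmap monalg.

Set Implicit Arguments.
Unset Strict Implicit.
Unset Printing Implicit Defensive.

Import GRing.Theory.
Local Open Scope ring_scope.

(* Rings are [pzRingType]s, so that the zero ring is not excluded; units are  *)
(* two-sided because path algebras are not commutative.                       *)

Definition is_unit (R : pzRingType) (u : R) : Prop :=
  exists v : R, u * v = 1 /\ v * u = 1.

Definition Delta_ring (p : nat) (R : pzRingType) : Prop :=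
  forall u : R, is_unit u -> u ^+ p = 1.

Definition ring_iso (R S : pzRingType) : Prop :=
  exists f : {rmorphism R -> S}, bijective f.

Definition Mersenne_prime (p : nat) : Prop :=
  prime p /\ exists m : nat, p = (2 ^ m - 1)%N.

Definition is_field_of_order (q : nat) (k : fieldType) : Prop :=
  exists F : finFieldType, #|F| = q /\ ring_iso k F.

Definition iso_F2_pow (R : pzRingType) : Prop :=
  exists a : nat, ring_iso R {ffun 'I_a -> 'F_2}.

(* {ffun 'I_a -> K} is the ring K^a with componentwise operations.            *)
Definition iso_F2_pow_Fq_pow (q : nat) (R : pzRingType) : Prop :=
  exists (F : finFieldType) (a b : nat), #|F| = q /\
    ring_iso R ({ffun 'I_a -> 'F_2} * {ffun 'I_b -> F})%type.

(* The algebra structures of the library exclude the zero ring, so a          *)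
(* commutative k-algebra is given by its structure morphism k -> R.           *)
Definition finite_dim_alg (k : fieldType) (R : comPzRingType)
    (iota : {rmorphism k -> R}) : Prop :=
  exists (n : nat) (e : 'I_n -> R),
    forall x : R, exists! c : {ffun 'I_n -> k}, x = \sum_i iota (c i) * e i.

(* The cyclic group of order p (p > 1) is the additive group of 'Z_p, and     *)
(* {malg M[I]} is the direct sum of copies of M indexed by I.                 *)
Definition elementary_abelian (p : nat) (G : zmodType) : Prop :=
  exists (I : choiceType) (f : {additive {malg 'Z_p[I]} -> G}), bijective f.

(* Integers modulo n for n > 0. Unlike 'Z_n, this is the zero ring for n = 1. *)
Definition Zmod (n : nat) : Type := 'I_n.-1.+1.

HB.instance Definition _ (n : nat) := GRing.Zmodule.on (Zmod n).
HB.instance Definition _ (n : nat) :=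
  GRing.Zmodule_isComPzRing.Build (Zmod n)
    (@Zp_mulA _) (@Zp_mulC _) (@Zp_mul1z _) (@Zp_mul_addl _).

(* A basis with a partial product: [bmul x y = None] stands for x * y = 0.    *)
(* The identity of the algebra is the sum of [bids]; [bmul1x] says that, for  *)
(* each x, exactly one e in [bids] satisfies e * x <> 0, and then e * x = x.  *)
HB.mixin Record isMulBasis B of Choice B := {
  bmul : B -> B -> option B;
  bids : seq B;
  bmulA : forall x y z,
    obind (bmul x) (bmul y z) = obind (bmul^~ z) (bmul x y);
  bmul1x : forall x, pmap (bmul^~ x) bids = [:: x];
  bmulx1 : forall x, pmap (bmul x) bids = [:: x]
}.

#[short(type="mulBasisType")]
HB.structure Definition MulBasis := { B of Choice B & isMulBasis B }.

Definition basis_alg (A : pzRingType) (B : mulBasisType) : Type := {malg A[B]}.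

Section BasisAlg.
Variables (A : pzRingType) (B : mulBasisType).
Implicit Types (g h : {malg A[B]}) (x y z : B) (s : {fset B}).

HB.instance Definition _ := GRing.Zmodule.copy (basis_alg A B) {malg A[B]}.

Definition omon (a : A) (ox : option B) : {malg A[B]} :=
  if ox is Some x then << a *g x >> else 0.

Definition balg_one : basis_alg A B := \sum_(x <- bids : seq B) << 1 *g x >>.

Definition balg_mul (g h : basis_alg A B) : basis_alg A B :=
  \sum_(x <- msupp g) \sum_(y <- msupp h) omon (g@_x * h@_y) (bmul x y).

Lemma omon0 ox : omon 0 ox = 0.
Proof. by case: ox => //= x; rewrite monalgU0. Qed.

Lemma omonD a b ox : omon (a + b) ox = omon a ox + omon b ox.
Proof. by case: ox => [x|] /=; rewrite ?addr0 ?monalgUD. Qed.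

Lemma balg_mulw s1 s2 g h : (msupp g `<=` s1)%fset -> (msupp h `<=` s2)%fset ->
  balg_mul g h = \sum_(x <- s1) \sum_(y <- s2) omon (g@_x * h@_y) (bmul x y).
Proof.
move=> le1 le2; rewrite /balg_mul (big_fset_incl _ le1) /=.
  apply: eq_bigr => x _; apply: big_fset_incl => // y _ /mcoeff_outdom ->.
  by rewrite mulr0 omon0.
move=> x _ /mcoeff_outdom ->; rewrite big1 // => y _.
by rewrite mul0r omon0.
Qed.

Lemma balg_mulUU a b x y :
  balg_mul << a *g x >> << b *g y >> = omon (a * b) (bmul x y).
Proof. by rewrite (balg_mulw msuppU_le msuppU_le) !big_seq_fset1 !mcoeffUU. Qed.

Lemma balg_mulDl : left_distributive balg_mul +%R.
Proof.
move=> f g h; pose s := (msupp f `|` msupp g)%fset.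
rewrite (@balg_mulw s (msupp h) (f + g)) ?msuppD_le ?fsubset_refl //.
rewrite (@balg_mulw s (msupp h) f) ?fsubsetUl ?fsubset_refl //.
rewrite (@balg_mulw s (msupp h) g) ?fsubsetUr ?fsubset_refl //.
rewrite -big_split; apply: eq_bigr => x _; rewrite -big_split.
by apply: eq_bigr => y _; rewrite mcoeffD mulrDl omonD.
Qed.

Lemma balg_mulDr : right_distributive balg_mul +%R.
Proof.
move=> h f g; pose s := (msupp f `|` msupp g)%fset.
rewrite (@balg_mulw (msupp h) s _ (f + g)) ?msuppD_le ?fsubset_refl //.
rewrite (@balg_mulw (msupp h) s _ f) ?fsubsetUl ?fsubset_refl //.
rewrite (@balg_mulw (msupp h) s _ g) ?fsubsetUr ?fsubset_refl //.
rewrite -big_split; apply: eq_bigr => x _; rewrite -big_split.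
by apply: eq_bigr => y _; rewrite mcoeffD mulrDr omonD.
Qed.

Lemma balg_mul0l h : balg_mul 0 h = 0.
Proof. by rewrite /balg_mul msupp0 big_seq_fset0. Qed.

Lemma balg_mul0r h : balg_mul h 0 = 0.
Proof. by rewrite /balg_mul big1 // => x _; rewrite msupp0 big_seq_fset0. Qed.

Lemma balg_mul_suml I (r : seq I) (F : I -> basis_alg A B) h :
  balg_mul (\sum_(i <- r) F i) h = \sum_(i <- r) balg_mul (F i) h.
Proof.
elim: r => [|i r IH]; first by rewrite !big_nil balg_mul0l.
by rewrite !big_cons balg_mulDl IH.
Qed.

Lemma balg_mul_sumr I (r : seq I) (F : I -> basis_alg A B) h :
  balg_mul h (\sum_(i <- r) F i) = \sum_(i <- r) balg_mul h (F i).
Proof.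
elim: r => [|i r IH]; first by rewrite !big_nil balg_mul0r.
by rewrite !big_cons balg_mulDr IH.
Qed.

Lemma balg_mul_monA a b c x y z :
  balg_mul << a *g x >> (balg_mul << b *g y >> << c *g z >>)
  = balg_mul (balg_mul << a *g x >> << b *g y >>) << c *g z >>.
Proof.
have omonr r d o : balg_mul << r *g x >> (omon d o) =
    omon (r * d) (obind (bmul x) o).
  by case: o => [w|] /=; rewrite ?balg_mulUU ?balg_mul0r.
have omonl r d o : balg_mul (omon d o) << r *g z >> =
    omon (d * r) (obind (bmul^~ z) o).
  by case: o => [w|] /=; rewrite ?balg_mulUU ?balg_mul0l.
by rewrite !balg_mulUU omonr omonl bmulA mulrA.
Qed.

Lemma balg_mulEl g h :
  balg_mul g h = \sum_(x <- msupp g) balg_mul << g@_x *g x >> h.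
Proof. by rewrite -balg_mul_suml -monalgE. Qed.

Lemma balg_mulEr g h :
  balg_mul g h = \sum_(x <- msupp h) balg_mul g << h@_x *g x >>.
Proof. by rewrite -balg_mul_sumr -monalgE. Qed.

Lemma balg_mulA : associative balg_mul.
Proof.
move=> f g h.
rewrite [LHS]balg_mulEl [balg_mul f g]balg_mulEl balg_mul_suml.
apply: eq_bigr => x _.
rewrite [balg_mul g h]balg_mulEl balg_mul_sumr.
rewrite [balg_mul _ g]balg_mulEr balg_mul_suml; apply: eq_bigr => y _.
rewrite [balg_mul _ h in LHS]balg_mulEr balg_mul_sumr [RHS]balg_mulEr.
by apply: eq_bigr => z _; rewrite balg_mul_monA.
Qed.

Lemma omon_pmap (a : A) (f : B -> option B) (r : seq B) :
  \sum_(e <- r) omon a (f e) = \sum_(x <- pmap f r) << a *g x >>.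
Proof.
elim: r => [|e r IH]; first by rewrite !big_nil.
by rewrite big_cons /=; case: (f e) => [x|] /=; rewrite ?big_cons ?add0r IH.
Qed.

Lemma balg_mul1l : left_id balg_one balg_mul.
Proof.
move=> g; rewrite [LHS]balg_mulEr [RHS]monalgE.
apply: eq_bigr => x _; rewrite balg_mul_suml.
under eq_bigr do rewrite balg_mulUU mul1r.
by rewrite omon_pmap bmul1x big_seq1.
Qed.

Lemma balg_mul1r : right_id balg_one balg_mul.
Proof.
move=> g; rewrite [LHS]balg_mulEl [RHS]monalgE.
apply: eq_bigr => x _; rewrite balg_mul_sumr.
under eq_bigr do rewrite balg_mulUU mulr1.
by rewrite omon_pmap bmulx1 big_seq1.
Qed.

HB.instance Definition _ := GRing.Zmodule_isPzRing.Build (basis_alg A B)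
  balg_mulA balg_mul1l balg_mul1r balg_mulDl balg_mulDr.

End BasisAlg.

(* Abelian groups are written additively: the product of two basis elements   *)
(* of the group ring is their sum in G.                                       *)
Definition group_basis (G : zmodType) : Type := G.

Section GroupRing.
Variable G : zmodType.

HB.instance Definition _ := Choice.on (group_basis G).

Definition gb_mul (x y : group_basis G) : option (group_basis G) :=
  Some ((x : G) + (y : G)).

Lemma gb_mulA x y z :
  obind (gb_mul x) (gb_mul y z) = obind (gb_mul^~ z) (gb_mul x y).
Proof. by rewrite /gb_mul /= addrA. Qed.

Lemma gb_mul1x x : pmap (gb_mul^~ x) [:: (0 : G)] = [:: x].
Proof. by rewrite /= add0r. Qed.

Lemma gb_mulx1 x : pmap (gb_mul x) [:: (0 : G)] = [:: x].
Proof. by rewrite /= addr0. Qed.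

HB.instance Definition _ :=
  isMulBasis.Build (group_basis G) gb_mulA gb_mul1x gb_mulx1.

End GroupRing.

Definition group_ring (A : pzRingType) (G : zmodType) : pzRingType :=
  basis_alg A (group_basis G).

Record finite_quiver : Type := FiniteQuiver {
  vertex : finType;
  arrow : finType;
  source : arrow -> vertex;
  target : arrow -> vertex
}.

Section Paths.
Variable Q : finite_quiver.

Fixpoint is_walk (v : vertex Q) (s : seq (arrow Q)) : bool :=
  if s is a :: s' then (source a == v) && is_walk (target a) s' else true.

(* A path is its starting vertex with its arrows in the order of traversal;   *)
(* the path (v, [::]) is the length 0 path e_v.                               *)
Record qpath : Type := QPath {
  path_data : vertex Q * seq (arrow Q);
  path_dataP : is_walk path_data.1 path_data.2
}.

HB.instance Definition _ := [isSub for path_data].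
HB.instance Definition _ := [Choice of qpath by <:].

Definition path_arrows (x : qpath) : seq (arrow Q) := (path_data x).2.
Definition path_start (x : qpath) : vertex Q := (path_data x).1.
Definition path_end (x : qpath) : vertex Q :=
  last (path_start x) (map (@target Q) (path_arrows x)).

Definition trivial_path (v : vertex Q) : qpath :=
  @QPath (v, [::]) (erefl true).

Lemma is_walk_cat v s t :
  is_walk v (s ++ t) = is_walk v s && is_walk (last v (map (@target Q) s)) t.
Proof. by elim: s v => //= a s IH v; rewrite IH andbA. Qed.

(* x * y is y followed by x. *)
Definition path_mul (x y : qpath) : option qpath :=
  if path_end y == path_start x
  then insub (path_start y, path_arrows y ++ path_arrows x) else None.

Definition path_ids : seq qpath := map trivial_path (enum (vertex Q)).

Lemma path_end_cat x y z : path_start z = path_start y ->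
  path_arrows z = path_arrows y ++ path_arrows x ->
  path_end y = path_start x -> path_end z = path_end x.
Proof.
by move=> e1 e2 e; rewrite {1}/path_end e1 e2 map_cat last_cat -/(path_end y) e.
Qed.

Lemma path_mulP x y :
  if path_end y == path_start x then
    exists z, [/\ path_mul x y = Some z, path_start z = path_start y,
      path_end z = path_end x & path_arrows z = path_arrows y ++ path_arrows x]
  else path_mul x y = None.
Proof.
rewrite /path_mul; case: eqP => // e.
have w : is_walk (path_start y) (path_arrows y ++ path_arrows x).
  rewrite is_walk_cat -/(path_end y) e.
  by rewrite (path_dataP x) (path_dataP y).
exists (@QPath (_, _) w); split=> //.
- by rewrite insubT.
- exact: path_end_cat e.
Qed.

Lemma qpath_eq x y : path_start x = path_start y ->
  path_arrows x = path_arrows y -> x = y.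
Proof.
case: x y => [[u s] i] [[v t] j] /= e1 e2; apply: val_inj => /=.
by move: e1 e2; rewrite /path_start /path_arrows /= => -> ->.
Qed.

Lemma path_mulA x y z :
  obind (path_mul x) (path_mul y z) = obind (path_mul^~ z) (path_mul x y).
Proof.
have := path_mulP y z; have := path_mulP x y.
case: eqP => [e1 [xy [-> s1 t1 a1]]|e1 ->];
  case: eqP => [e2 [yz [-> s2 t2 a2]]|e2 ->] //=.
- have := path_mulP x yz; have := path_mulP xy z.
  rewrite t2 s1 e1 e2 !eqxx => -[u [-> su _ au]] [v [-> sv _ av]].
  congr Some; apply: qpath_eq; first by rewrite su sv s2.
  by rewrite au av a1 a2 catA.
- by have := path_mulP xy z; rewrite s1; case: eqP.
- by have := path_mulP x yz; rewrite t2; case: eqP.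
Qed.

Lemma pmap_pred1 (I : eqType) T (F : I -> option T) (r : seq I) i t :
  uniq r -> i \in r -> (forall j, F j = if j == i then Some t else None) ->
  pmap F r = [:: t].
Proof.
move=> + + H; elim: r => //= j r IH /andP[jr ur]; rewrite inE H eq_sym.
case: (eqVneq j i) => [ji _ /=|_ /= ir]; last exact: IH.
congr cons; have /= {IH}: i \notin r by rewrite -ji.
elim: r {jr ur} => //= l r IH; rewrite inE negb_or H eq_sym.
move=> /andP[/negbTE-> ir].
exact: IH.
Qed.

Lemma pmap_path_ids (f : qpath -> option qpath) v x :
  (forall u, f (trivial_path u) = if u == v then Some x else None) ->
  pmap f path_ids = [:: x].
Proof.
move=> H; rewrite /path_ids.
have -> : pmap f (map trivial_path (enum (vertex Q))) =
          pmap (fun u => if u == v then Some x else None) (enum (vertex Q)).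
  by elim: (enum _) => //= u r ->; rewrite H.
by apply: (@pmap_pred1 _ _ _ _ v); rewrite ?enum_uniq ?mem_enum.
Qed.

Lemma path_mul1x x : pmap (path_mul^~ x) path_ids = [:: x].
Proof.
apply: (@pmap_path_ids _ (path_end x)) => u.
have := path_mulP (trivial_path u) x; rewrite /= [u == _]eq_sym.
case: ifP => // _ [z [-> s _ a]]; congr Some; apply: qpath_eq => //.
by rewrite a cats0.
Qed.

Lemma path_mulx1 x : pmap (path_mul x) path_ids = [:: x].
Proof.
apply: (@pmap_path_ids _ (path_start x)) => u.
have := path_mulP x (trivial_path u); rewrite /path_end /=.
by case: eqP => // e [z [-> s _ a]]; congr Some; apply: qpath_eq; rewrite // s.
Qed.

HB.instance Definition _ :=
  isMulBasis.Build qpath path_mulA path_mul1x path_mulx1.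

Definition acyclic : Prop :=
  forall x : qpath, path_start x = path_end x -> path_arrows x = [::].

Definition trivial_quiver : Prop := #|arrow Q| = 0%N.

End Paths.

Definition path_algebra (k : fieldType) (Q : finite_quiver) : pzRingType :=
  basis_alg k (qpath Q).

(* Main.v *)
(* In a Delta_p-ring with p odd, -1 is a unit, so 2 = 0; if x^2 = 0 then 1 +  *)
(* x is a unit, so p x = 0 and x = 0. If moreover x^N = x for some N > 2,     *)
(* then x + 1 - x^(N-1) is a unit, and hence x^(p+1) = x.                     *)
(* A finite commutative Delta_p-ring R thus satisfies x^(p+1) = x             *)
(* identically; it is the product of the fields e R, e ranging over the       *)
(* primitive idempotents, and the nonzero elements of e R form a cyclic group *)
(* of order dividing p. A finite-dimensional algebra reduces to this case,    *)
(* its base field being finite.                                               *)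
(* In F_2 G, Frobenius shows that x^(2^m) = x for all x when (2^m - 1) G = 0. *)
(* Conversely, for g <> 0 in G, (1 + g)^(p+1) = 1 + g forces p + 1 to be a    *)
(* power of 2. In a path algebra an arrow squares to 0.                       *)

Require Import Defs.
From HB Require Import structures.
From mathcomp Require Import all_boot all_order all_algebra all_field.
From mathcomp Require Import all_fingroup all_solvable.
From mathcomp Require Import finmap monalg.
From mathcomp Require boolp classical_sets.

Import GRing.Theory.
Local Open Scope ring_scope.

(** Since [p] is odd, the unit -1 forces characteristic 2 ([Delta_ring_char2]), and then units 1 + x
    with x^2 = 0 rule out nonzero nilpotents ([Delta_ring_square0]). The pivot is
    [Delta_ring_periodic]: a periodic element becomes a unit once a complementary idempotent is
    added, which turns the condition on units into the equation x^(p+1) = x.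

    In a finite reduced commutative ring every element is periodic, by pigeonhole
    ([finComPzRing_reduced_periodic]). A primitive idempotent e then cuts out a field eR with cyclic
    unit group of exponent [p], so of order 2 or p + 1, and in the second case p + 1 is a power of 2
    ([finField_unit_exponent]). The primitive idempotents are orthogonal with sum 1, so R is the
    product of these fields, and [finField_iso] identifies those of equal order. A
    finite-dimensional algebra is zero or has a base field made of roots of X^(p+1) - X; in both
    cases it is finite.

    For group rings, characteristic 2 leaves n = 2 besides the zero ring. Elements of G are units,
    so pG = 0 and G is a vector space over F_p, with a basis by Zorn's lemma
    ([exponent_elementary_abelian]). That p is Mersenne comes from the coefficients of (1 + g)^(p+1)
    = 1 + g ([Delta_group_Mersenne]). In a path algebra on at least one vertex, the absence of
    nilpotents excludes arrows; what remains is a power of k, and the constants give the condition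
    on k. *)

(** * Units, square-zero elements and periodic elements *)

Lemma exprD_orthogonal (R : pzRingType) (x y : R) n : (0 < n)%N ->
  x * y = 0 -> y * x = 0 -> (x + y) ^+ n = x ^+ n + y ^+ n.
Proof.
move=> + xy yx; elim: n => // -[|n] IH _; first by rewrite !expr1.
rewrite exprS IH // mulrDl !mulrDr -!exprS (exprS x n) (exprS y n) !mulrA.
by rewrite xy yx !mul0r addr0 add0r !exprS !mulrA.
Qed.

Lemma Delta_ring_char2 (p : nat) (R : pzRingType) :
  odd p -> Delta_ring p R -> 1 + 1 = 0 :> R.
Proof.
move=> p_odd /(_ (-1)); rewrite -signr_odd p_odd expr1 => H.
by rewrite -{1}H ?addNr //; exists (-1); rewrite mulrNN mulr1.
Qed.

Lemma addrr2 (R : pzRingType) (x : R) : 1 + 1 = 0 :> R -> x + x = 0.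
Proof. by move=> R2; rewrite -[x]mul1r -mulrDl R2 mul0r. Qed.

Lemma mulrn_odd (R : pzRingType) (x : R) n : 1 + 1 = 0 :> R ->
  x *+ n = x *+ odd n.
Proof.
move=> R2; elim: n => // n IH; rewrite mulrSr IH /=.
by case: (odd n); rewrite ?add0r //= mulr1n addrr2.
Qed.

Lemma expr_1Dsquare0 (R : pzRingType) (x : R) n :
  x * x = 0 -> (1 + x) ^+ n = 1 + x *+ n.
Proof.
move=> xx; elim: n => [|n IH]; first by rewrite expr0 mulr0n addr0.
rewrite exprSr IH mulrDl mul1r mulrDr mulr1 mulrnAl xx mul0rn addr0.
by rewrite -addrA -mulrS.
Qed.

(** The unit 1 + x, with inverse 1 - x, has [p]-th power 1 + px, which is 1 + x in characteristic
    2. *)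
Lemma Delta_ring_square0 (p : nat) (R : pzRingType) (x : R) :
  odd p -> Delta_ring p R -> x * x = 0 -> x = 0.
Proof.
move=> p_odd Rp xx; have R2 := Delta_ring_char2 _ _ p_odd Rp.
have := Rp (1 + x); rewrite expr_1Dsquare0 // mulrn_odd // p_odd => H.
apply: (addrI 1); rewrite addr0 H //; exists (1 - x).
by rewrite mulrBr mulrBl !mulrDl !mulrDr !mul1r !mulr1 xx !addr0 addrK.
Qed.

(** The power e = x^(n+2) is an idempotent fixing x, and x is invertible relative to e. Adding 1 - e
    gives a unit of R, whose [p]-th power x^p + (1 - e) equals 1; hence x^p = e. *)
Lemma Delta_ring_periodic (p n : nat) (R : pzRingType) (x : R) :
  (0 < p)%N -> Delta_ring p R -> x ^+ n.+3 = x -> x ^+ p.+1 = x.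
Proof.
move=> p_gt0 Rp xn; pose e := x ^+ n.+2.
have xe : x * e = x by rewrite -exprS.
have ex : e * x = x by rewrite -exprSr.
have ee : e * e = e by rewrite {2}/e exprS mulrA ex.
have x1e : x * (1 - e) = 0 by rewrite mulrBr mulr1 xe subrr.
have e1x : (1 - e) * x = 0 by rewrite mulrBl mul1r ex subrr.
have ide : (1 - e) * (1 - e) = 1 - e.
  by rewrite mulrBr mulr1 mulrBl mul1r ee subrr subr0.
have idn m : (0 < m)%N -> (1 - e) ^+ m = 1 - e.
  by elim: m => // -[|m] IH _ //; rewrite exprS IH.
have := Rp (x + (1 - e)); rewrite exprD_orthogonal // idn // => H.
have {}H : x ^+ p = e.
  apply: (addIr (1 - e)); rewrite H; first by rewrite addrC subrK.
  have xn1e : x ^+ n.+1 * (1 - e) = 0 by rewrite exprSr -mulrA x1e mulr0.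
  have e1xn : (1 - e) * x ^+ n.+1 = 0 by rewrite exprS mulrA e1x mul0r.
  (* The exponent n + 1 is positive, so x^(n+1) is still annihilated by 1 - e; this is why
     periodicity is assumed with exponent at least 3. *)
  exists (x ^+ n.+1 + (1 - e)).
  move: (1 - e) x1e e1x ide xn1e e1xn (subrK e 1) => f x1e e1x ide xn1e e1xn fe.
  rewrite !mulrDl !mulrDr ide -exprS -exprSr x1e e1x xn1e e1xn.
  by rewrite addr0 add0r addrC fe.
by rewrite exprS H.
Qed.

(** * Finite fields *)

Lemma finField_generator (K : finFieldType) :
  exists z : K, forall x : K, x != 0 -> exists i, x = z ^+ i.
Proof.
have /cyclicP[u Hu] := field_unit_group_cyclic [set: {unit K}]%G.
exists (val u) => x x0.
have: finField_unit x0 \in <[u]>%g by rewrite -Hu inE.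
move=> /cycleP[i /(congr1 val)]; rewrite /= FinRing.val_unitX => ->.
by exists i.
Qed.

(** The order of a generator of the cyclic unit group divides the prime [p]. *)
Lemma finField_card_unit_exponent (K : finFieldType) (p : nat) :
  prime p -> (forall x : K, x != 0 -> x ^+ p = 1) ->
  #|K| = 2 \/ #|K| = p.+1.
Proof.
move=> p_prime Kp.
have /cyclicP[u Hu] := field_unit_group_cyclic [set: {unit K}]%G.
have up : (#[u]%g %| p)%N.
  rewrite order_dvdn; apply/eqP/val_inj; rewrite FinRing.val_unitX Kp //.
  by rewrite -unitfE (valP u).
have := card_finField_unit K; rewrite Hu -orderE.
have K_gt0 : (0 < #|K|)%N by apply/card_gt0P; exists 0.
rewrite -{2 3}(prednK K_gt0) => <-.
by have /primeP[_ /(_ _ up) /orP[] /eqP ->] := p_prime; [left|right].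
Qed.

Lemma finField_char2_card (K : finFieldType) :
  1 + 1 = 0 :> K -> exists m, #|K| = (2 ^ m)%N.
Proof.
move=> K2; have chK : 2%N \in [pchar K] by rewrite inE /= mulr2n K2.
exists (logn 2 #|K|); exact: card_pprimeChar chK.
Qed.

Lemma finField_unit_exponent (K : finFieldType) (p : nat) :
  prime p -> odd p -> (forall x : K, x != 0 -> x ^+ p = 1) ->
  #|K| = 2 \/ Mersenne_prime p /\ #|K| = p.+1.
Proof.
move=> p_prime p_odd Kp.
have [|Kc] := finField_card_unit_exponent K p p_prime Kp; [by left|right].
split=> //; split=> //.
have [|m Km] := finField_char2_card K.
  have := Kp (-1); rewrite -signr_odd p_odd expr1 oppr_eq0 oner_eq0.
  move=> /(_ isT) H; by rewrite -{1}H addNr.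
by exists m; rewrite -Km Kc subn1.
Qed.

(* Let [m] be the minimal polynomial of [z] and [w] a root of [m] in [M];     *)
(* then [q(z) |-> q(w)], for [q] in [{poly F}], is well defined.              *)
Lemma fieldExt_splitting_hom (F : fieldType) (L M : fieldExtType F) (z : L)
    (g : {poly F}) (s : seq M) :
  (forall x : L, exists q : {poly F}, (map_poly (in_alg L) q).[z] = x) ->
  root (map_poly (in_alg L) g) z ->
  map_poly (in_alg M) g = \prod_(y <- s) ('X - y%:P) ->
  exists f : {rmorphism L -> M}, True.
Proof.
move=> Lz gz gM.
have /polyOver1P[m Hm] := minPolyOver 1%AS z.
have mP q : root (map_poly (in_alg L) q) z = (m %| q).
  rewrite -(dvdp_map (in_alg L)) -Hm.
  apply/idP/idP => [|/dvdpP[r ->]]; last by rewrite rootM root_minPoly orbT.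
  by apply: minPoly_dvdp; apply/polyOver1P; exists q.
(* Over M, the polynomial m divides the split polynomial g, and it is not constant, so at least one
   linear factor occurs in it. *)
have [w mw] : exists w : M, root (map_poly (in_alg M) m) w.
  have : map_poly (in_alg M) m %| \prod_(y <- s) ('X - y%:P).
    by rewrite -gM dvdp_map -mP.
  move=> /dvdp_prod_XsubC[t mt].
  have : size (map_poly (in_alg M) m) != 1%N.
    by rewrite size_map_poly -(size_map_poly (in_alg L)) -Hm size_minPoly eqSS.
  rewrite (eqp_size mt); case E: (mask t s) mt => [|w r] mt.
    by rewrite big_nil size_poly1.
  by move=> _; exists w; rewrite (eqp_root mt) big_cons rootM root_XsubC eqxx.
have Lz' x : exists q : {poly F}, (map_poly (in_alg L) q).[z] == x.
  by have [q <-] := Lz x; exists q.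
pose f x := (map_poly (in_alg M) (xchoose (Lz' x))).[w].
have fE q : f (map_poly (in_alg L) q).[z] = (map_poly (in_alg M) q).[w].
  apply/eqP; rewrite /f -subr_eq0 -hornerN -hornerD -rmorphN -rmorphD /=.
  set r := xchoose _; suff /dvdpP[h ->] : m %| r - q.
    by rewrite rmorphM hornerM (rootP mw) mulr0.
  rewrite -mP /root rmorphB hornerD hornerN subr_eq0 /=.
  by rewrite (eqP (xchooseP (Lz' _))).
have fD : {morph f : x y / x + y}.
  move=> x y; have [[q <-] [r <-]] := (Lz x, Lz y).
  by rewrite -hornerD -rmorphD !fE rmorphD hornerD.
have fM : {morph f : x y / x * y}.
  move=> x y; have [[q <-] [r <-]] := (Lz x, Lz y).
  by rewrite -hornerM -rmorphM !fE rmorphM hornerM.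
have f1 : f 1 = 1 by have := fE 1; rewrite !rmorph1 -!polyC1 !hornerC.
have f0 : f 0 = 0 by apply: (addrI (f 0)); rewrite -fD !addr0.
pose a := GRing.isNmodMorphism.Build _ _ f (conj f0 fD).
pose b := GRing.isMonoidMorphism.Build _ _ f (conj f1 fM).
by exists (HB.pack_for {rmorphism L -> M} f a b).
Qed.

(** Over the common prime field, K is generated by a root of X^q - X, a polynomial that splits in F.
    The resulting morphism of fields is injective, hence bijective by counting. *)
Lemma finField_iso (K F : finFieldType) : #|K| = #|F| -> ring_iso K F.
Proof.
move=> KF; have [p p_prime chK] := finPcharP K.
have chF : p \in [pchar F].
  apply: (@card_finPcharP F p (logn p #|K|)) => //.
  rewrite -KF; exact: card_pprimeChar chK.
have [z Hz] := finField_generator K.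
pose K' := pPrimeCharType chK; pose F' := pPrimeCharType chF.
have [f _] : exists f : {rmorphism K' -> F'}, True.
  apply: (@fieldExt_splitting_hom _ K' F' z ('X^#|F| - 'X) (index_enum F)).
  - move=> x; have [->|x0] := eqVneq x 0.
      by exists 0; rewrite rmorph0 horner0.
    by have [i ->] := Hz x x0; exists ('X^i); rewrite map_polyXn hornerXn.
  - rewrite rmorphB /= map_polyXn map_polyX /root hornerD hornerN hornerXn.
    by rewrite hornerX subr_eq0 -KF (expf_card z).
  - rewrite rmorphB /= map_polyXn map_polyX.
    by rewrite (finField_genPoly F).
exists f; apply: (inj_card_bij _ _); first exact: fmorph_inj.
by rewrite KF.
Qed.

(** * Primitive idempotents *)

(** What makes the ring eR a field: by [idemX], x^(n+1) is the inverse of a nonzero x. The exponent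
    n + 2 is later [p]. *)
Record field_idempotent (R : pzRingType) (n : nat) : Type := FieldIdempotent {
  idem : R;
  idem_neq0 : idem != 0;
  idemM : idem * idem = idem;
  idemX : forall x, idem * x = x -> x != 0 -> x ^+ n.+2 = idem
}.

(** * The field eR *)

Section Corner.
Variables (R : finComPzRingType) (n : nat) (f : field_idempotent R n).
Local Notation e := (idem _ _ f).

Definition corner : predArgType := {x : R | e * x == x}.

HB.instance Definition _ := SubType.on corner.
HB.instance Definition _ := [Finite of corner by <:].

Lemma cornerP (x : corner) : e * val x = val x.
Proof. exact/eqP/(valP x). Qed.

Lemma corner_subproof (x : R) : e * (e * x) == e * x.
Proof. by rewrite mulrA idemM. Qed.

Definition to_corner (x : R) : corner := exist _ (e * x) (corner_subproof x).

Lemma val_to_corner x : val (to_corner x) = e * x.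
Proof. by []. Qed.

(** Going through [to_corner] makes closure under the operations automatic; the extra factor e is
    absorbed afterwards. *)
Definition corner_add (x y : corner) := to_corner (val x + val y).
Definition corner_opp (x : corner) := to_corner (- val x).
Definition corner_mul (x y : corner) := to_corner (val x * val y).
Definition corner_inv (x : corner) := to_corner (val x ^+ n.+1).

Lemma val_corner_add x y : val (corner_add x y) = val x + val y.
Proof. by rewrite /= mulrDr !cornerP. Qed.

Lemma val_corner_opp x : val (corner_opp x) = - val x.
Proof. by rewrite /= mulrN cornerP. Qed.

Lemma val_corner_mul x y : val (corner_mul x y) = val x * val y.
Proof. by rewrite /= mulrA cornerP. Qed.

Lemma corner_addA : associative corner_add.
Proof. by move=> x y z; apply: val_inj; rewrite !val_corner_add addrA. Qed.

Lemma corner_addC : commutative corner_add.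
Proof. by move=> x y; apply: val_inj; rewrite !val_corner_add addrC. Qed.

Lemma corner_add0 : left_id (to_corner 0) corner_add.
Proof.
by move=> x; apply: val_inj; rewrite val_corner_add val_to_corner mulr0 add0r.
Qed.

Lemma corner_addN : left_inverse (to_corner 0) corner_opp corner_add.
Proof.
move=> x; apply: val_inj.
by rewrite val_corner_add val_corner_opp val_to_corner mulr0 addNr.
Qed.

HB.instance Definition _ :=
  GRing.isZmodule.Build corner corner_addA corner_addC corner_add0 corner_addN.

Lemma corner_mulA : associative corner_mul.
Proof. by move=> x y z; apply: val_inj; rewrite !val_corner_mul mulrA. Qed.

Lemma corner_mulC : commutative corner_mul.
Proof. by move=> x y; apply: val_inj; rewrite !val_corner_mul mulrC. Qed.

Lemma corner_mul1 : left_id (to_corner 1) corner_mul.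
Proof.
move=> x; apply: val_inj.
by rewrite val_corner_mul val_to_corner mulr1 cornerP.
Qed.

Lemma corner_mulDl : left_distributive corner_mul corner_add.
Proof.
move=> x y z; apply: val_inj.
by rewrite !(val_corner_mul, val_corner_add) mulrDl.
Qed.

Lemma corner_oner_neq0 : to_corner 1 != to_corner 0.
Proof. by rewrite -val_eqE !val_to_corner mulr1 mulr0 idem_neq0. Qed.

HB.instance Definition _ := GRing.Zmodule_isComNzRing.Build corner
  corner_mulA corner_mulC corner_mul1 corner_mulDl corner_oner_neq0.

Lemma corner_mulV (x : corner) : x != 0 -> corner_inv x * x = 1.
Proof.
move=> x0; apply: val_inj.
rewrite val_corner_mul val_to_corner -mulrA -exprSr val_to_corner mulr1.
rewrite (idemX _ _ f) ?idemM ?cornerP //.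
by move: x0; rewrite -val_eqE val_to_corner mulr0.
Qed.

Lemma corner_inv0 : corner_inv 0 = 0.
Proof. by apply: val_inj; rewrite !val_to_corner mulr0 expr0n mulr0. Qed.

HB.instance Definition _ :=
  GRing.ComNzRing_isField.Build corner corner_mulV corner_inv0.

Lemma to_corner_is_nmod_morphism : nmod_morphism to_corner.
Proof.
by split=> // x y; apply: val_inj; rewrite val_corner_add !val_to_corner mulrDr.
Qed.

Lemma to_corner_is_monoid_morphism : monoid_morphism to_corner.
Proof.
split=> // x y; apply: val_inj; rewrite val_corner_mul !val_to_corner.
by rewrite mulrACA idemM.
Qed.

HB.instance Definition _ :=
  GRing.isNmodMorphism.Build R corner to_corner to_corner_is_nmod_morphism.
HB.instance Definition _ :=
  GRing.isMonoidMorphism.Build R corner to_corner to_corner_is_monoid_morphism.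

Lemma to_corner_eq0 x : (to_corner x == 0) = (e * x == 0).
Proof. by rewrite -val_eqE !val_to_corner mulr0. Qed.

Lemma to_cornerK (x : corner) : to_corner (val x) = x.
Proof. by apply: val_inj; rewrite val_to_corner cornerP. Qed.

Lemma corner_unit_exponent (x : corner) : x != 0 -> x ^+ n.+2 = 1.
Proof.
move=> x0; rewrite exprSr -[X in X ^+ _]to_cornerK -rmorphXn.
exact: corner_mulV.
Qed.
End Corner.

(** * Product decompositions from orthogonal idempotents *)

Lemma bij_ring_iso (R S : pzRingType) (f : {rmorphism R -> S}) :
  (forall x, f x = 0 -> x = 0) -> (forall y, exists x, f x = y) -> ring_iso R S.
Proof.
move=> f_inj f_surj; exists f.
have f_surj' y : exists x, f x == y by have [x <-] := f_surj y; exists x.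
exists (fun y => xchoose (f_surj' y)) => [x|y].
  apply/eqP; rewrite -subr_eq0; apply/eqP/f_inj; rewrite rmorphB.
  by rewrite (eqP (xchooseP (f_surj' (f x)))) subrr.
exact/eqP/(xchooseP (f_surj' y)).
Qed.

(* [phi] is, up to an isomorphism of [S] with the ring [e R], the projection  *)
(* [x |-> e x].                                                               *)
Definition corner_projection (R : comPzRingType) (S : pzRingType) (e : R)
    (phi : {rmorphism R -> S}) : Prop :=
  (forall y, exists x, phi x = y) /\ forall x, phi x = 0 <-> e * x = 0.

Lemma corner_projection_idem (R : comPzRingType) (S : pzRingType) (e : R)
    (phi : {rmorphism R -> S}) :
  e * e = e -> corner_projection R S e phi -> phi e = 1.
Proof.
move=> ee [_ /(_ (1 - e))[_]]; rewrite mulrBr mulr1 ee subrr => /(_ erefl).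
by rewrite rmorphB rmorph1 => /eqP; rewrite subr_eq0 => /eqP <-.
Qed.

Lemma corner_projection1 (R : comPzRingType) (S : pzRingType)
    (phi : {rmorphism R -> S}) : corner_projection R S 1 phi -> ring_iso R S.
Proof.
move=> [phi_surj phi_ker]; apply: (bij_ring_iso _ _ phi) => // x /phi_ker.
by rewrite mul1r.
Qed.

Lemma corner_projection_pair (R : comPzRingType) (S T : pzRingType) (d e : R)
    (phi : {rmorphism R -> S}) (psi : {rmorphism R -> T}) :
  d * e = 0 -> d + e = 1 ->
  corner_projection R S d phi -> corner_projection R T e psi ->
  ring_iso R (S * T)%type.
Proof.
move=> de de1 Pphi Ppsi.
have dd : d * d = d by rewrite -[RHS]mulr1 -de1 mulrDr de addr0.
have ee : e * e = e by rewrite -[RHS]mul1r -de1 mulrDl de add0r.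
have phid := corner_projection_idem _ _ _ _ dd Pphi.
have psie := corner_projection_idem _ _ _ _ ee Ppsi.
move: Pphi Ppsi => [phi_surj phi_ker] [psi_surj psi_ker].
have phie : phi e = 0 by apply/phi_ker.
have psid : psi d = 0 by apply/psi_ker; rewrite mulrC.
pose f x := (phi x, psi x).
have f_add : nmod_morphism f.
  by split=> [|x y]; rewrite /f ?rmorph0 ?rmorphD.
have f_mul : monoid_morphism f.
  by split=> [|x y]; rewrite /f ?rmorph1 ?rmorphM.
pose a := GRing.isNmodMorphism.Build _ _ f f_add.
pose b := GRing.isMonoidMorphism.Build _ _ f f_mul.
apply: (bij_ring_iso _ _ (HB.pack_for {rmorphism R -> (S * T)%type} f a b)).
  move=> x [/phi_ker dx /psi_ker ex].
  by rewrite -[x]mul1r -de1 mulrDl dx ex addr0.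
move=> [y z]; have [[x <-] [w <-]] := (phi_surj y, psi_surj z).
(* Chinese remainder: phi sends d, e to 1, 0 and psi sends them to 0, 1. *)
exists (d * x + e * w); rewrite /= /f !rmorphD !rmorphM phid phie psid psie.
by rewrite !mul1r !mul0r addr0 add0r.
Qed.

Lemma corner_projection_family (R : finComPzRingType) (S : pzRingType)
    (E : {set R}) :
  (forall e, e \in E -> e * e = e) ->
  {in E &, forall d e, d != e -> d * e = 0} ->
  (forall e, e \in E -> exists phi, corner_projection R S e phi) ->
  exists phi : {rmorphism R -> {ffun 'I_#|E| -> S}},
    corner_projection R _ (\sum_(e in E) e) phi.
Proof.
move=> Eid Eorth Ecor.
have EsumE d : d \in E -> d * \sum_(e in E) e = d.
  move=> dE; rewrite mulr_sumr (bigD1 d) //= Eid // big1 ?addr0 //.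
  by move=> e /andP[eE ed]; rewrite Eorth // eq_sym.
have Ei (i : 'I_#|E|) : enum_val i \in E by exact: enum_valP.
have [phi Pphi] := fin_all_exists (fun i => Ecor _ (Ei i)).
pose f x := [ffun i => phi i x].
have f_add : nmod_morphism f.
  by split=> [|x y]; apply/ffunP => i; rewrite !ffunE ?rmorph0 ?rmorphD.
have f_mul : monoid_morphism f.
  by split=> [|x y]; apply/ffunP => i; rewrite !ffunE ?rmorph1 ?rmorphM.
pose a := GRing.isNmodMorphism.Build _ _ f f_add.
pose b := GRing.isMonoidMorphism.Build _ _ f f_mul.
exists (HB.pack_for {rmorphism R -> {ffun 'I_#|E| -> S}} f a b).
split=> [y|x].
  have [x Hx] := fin_all_exists (fun i => (Pphi i).1 (y i)).
  (* By orthogonality, the [j]-th projection kills every summand but the [j]-th and maps its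
     idempotent to 1. *)
  exists (\sum_i enum_val i * x i); apply/ffunP => j.
  rewrite [LHS]ffunE rmorph_sum (bigD1 j) //= big1 => [|i ij].
    rewrite rmorphM (corner_projection_idem _ _ _ _ (Eid _ (Ei j))) //.
    by rewrite Hx mul1r addr0.
  have /(Pphi j).2 : enum_val j * enum_val i = 0.
    by apply: Eorth => //; rewrite (inj_eq enum_val_inj) eq_sym.
  by rewrite rmorphM => ->; rewrite mul0r.
split=> [fx0|Ex].
  rewrite mulr_suml big1 // => e eE.
  have /ffunP/(_ (enum_rank_in eE e)) := fx0; rewrite !ffunE.
  by move=> /(Pphi _).2; rewrite enum_rankK_in.
apply/ffunP => i; rewrite !ffunE; apply/(Pphi i).2.
by rewrite -[enum_val i]EsumE // -mulrA Ex mulr0.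
Qed.

Lemma corner_projection_field (R : finComPzRingType) (n : nat)
    (f : field_idempotent R n) (K : finFieldType) :
  #|corner R n f| = #|K| -> exists phi, corner_projection R K (idem R n f) phi.
Proof.
move=> cK; have [g [h gK hK]] := finField_iso (corner R n f) K cK.
exists (g \o to_corner R n f); split=> [y|x] /=.
  by exists (val (h y)); rewrite to_cornerK hK.
by split=> /eqP H; apply/eqP; move: H; rewrite fmorph_eq0 to_corner_eq0.
Qed.

(** * Existence and completeness of primitive idempotents *)

Section PrimitiveIdempotents.
Variable R : finComPzRingType.

(** Minimal nonzero idempotents for the order in which f lies below e when e f = f. *)
Definition primitive_idem : {set R} :=
  [set e | [&& e != 0, e * e == e &
    [forall f, (f * f == f) && (e * f == f) ==> (f == 0) || (f == e)]]].

Lemma primitive_idemP (e : R) :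
  reflect [/\ e != 0, e * e = e &
             forall f, f * f = f -> e * f = f -> f != 0 -> f = e]
          (e \in primitive_idem).
Proof.
rewrite inE; apply: (iffP and3P) => [[e0 /eqP ee /forallP H]|[e0 ee H]].
  split=> // f ff ef f0; have := H f; rewrite ff ef !eqxx (negPf f0) /=.
  by move/eqP.
split; rewrite ?ee //; apply/forallP => f.
apply/implyP => /andP[/eqP ff /eqP ef].
by case: (eqVneq f 0) => //= f0; apply/eqP/H.
Qed.

Lemma primitive_idem_orthogonal :
  {in primitive_idem &, forall d e, d != e -> d * e = 0}.
Proof.
move=> d e /primitive_idemP[_ dd dP] /primitive_idemP[_ ee eP] /eqP de.
apply/eqP; apply: contraT => de0; case: de.
have ide : (d * e) * (d * e) = d * e by rewrite mulrACA dd ee.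
have Ed : d * e = d by apply: dP; rewrite // mulrA dd.
have Ee : d * e = e by apply: eP; rewrite // mulrCA ee.
exact: etrans (esym Ed) Ee.
Qed.

Lemma primitive_idem_below (t : R) : t * t = t -> t != 0 ->
  exists2 e, e \in primitive_idem & t * e = e.
Proof.
move=> tt t0.
pose P f := [&& f != 0, f * f == f & t * f == f].
pose fix_ f := [set x : R | f * x == x].
have Pt : P t by rewrite /P t0 tt eqxx.
(* The set [fix_ f] is the ideal fR. Choose e below t with the smallest ideal: an f below e then has
   fR = eR, so f fixes e and f = e. *)
case: (arg_minnP (fun f => #|fix_ f|) Pt) => e /and3P[e0 /eqP ee /eqP te] emin.
exists e => //; apply/primitive_idemP; split=> // f ff ef f0.
have : e \in fix_ f.
  have sub : fix_ f \subset fix_ e.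
    by apply/subsetP => x; rewrite !inE => /eqP fx; rewrite -fx mulrA ef.
  rewrite (_ : fix_ f = fix_ e); first by rewrite inE ee.
  apply/eqP; rewrite eqEcard sub emin //.
  by rewrite /P f0 ff -ef mulrA te !eqxx.
by rewrite inE mulrC ef => /eqP.
Qed.

(** Otherwise some primitive e lies below 1 - s, where s is the sum; but e s = e, so e (1 - s) =
    0. *)
Lemma sum_primitive_idem : \sum_(e in primitive_idem) e = 1.
Proof.
set s := \sum_(e in _) e.
have es e : e \in primitive_idem -> e * s = e.
  move=> eE; rewrite mulr_sumr (bigD1 e) //= big1 => [|d /andP[dE de]].
    by rewrite addr0; have /primitive_idemP[] := eE.
  by rewrite primitive_idem_orthogonal // eq_sym.
have ss : s * s = s by rewrite {1}/s mulr_suml; apply: eq_bigr.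
apply/eqP; rewrite eq_sym -subr_eq0; apply: contraT => t0.
have [|e eE te] := primitive_idem_below (1 - s) _ t0.
  by rewrite mulrBr mulr1 mulrBl mul1r ss subrr subr0.
have /primitive_idemP[/eqP[]] := eE.
by rewrite -te mulrC mulrBr mulr1 es // subrr.
Qed.

(** For a nonzero x in eR, the power x^(n+2) is a nonzero idempotent below e, hence e itself. *)
Lemma primitive_idem_field (n : nat) (e : R) :
  (forall x : R, x ^+ n.+3 = x) -> e \in primitive_idem ->
  exists f : field_idempotent R n, idem R n f = e.
Proof.
move=> Rn /primitive_idemP[e0 ee eP].
suff eX x : e * x = x -> x != 0 -> x ^+ n.+2 = e.
  by exists (FieldIdempotent R n e e0 ee eX).
move=> ex x0; apply: eP.
- by rewrite {2}exprS mulrA -exprSr Rn -exprS.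
- by rewrite exprS mulrA ex.
- by apply: contraNneq x0 => xn; rewrite -[x]Rn exprS xn mulr0.
Qed.

End PrimitiveIdempotents.

Lemma card_corner (R : finComPzRingType) (n : nat) (f : field_idempotent R n) :
  #|corner R n f| = #|[set x : R | idem R n f * x == x]|.
Proof. by rewrite card_sig cardsE. Qed.

(** * Periodicity in finite reduced rings *)

Lemma reduced_nilpotent (R : pzRingType) (x : R) n :
  (forall y : R, y * y = 0 -> y = 0) -> x ^+ n = 0 -> x = 0.
Proof.
move=> R_red xn; have: x ^+ (2 ^ n) = 0.
  by rewrite -(subnK (ltnW (ltn_expl n (ltnSn 1)))) exprD xn mulr0.
elim: n {xn} => [|n IH]; first by rewrite expr1.
by rewrite expnSr exprM expr2 => /R_red.
Qed.

Lemma finComPzRing_reduced_periodic (R : finComPzRingType) (x : R) :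
  (forall y : R, y * y = 0 -> y = 0) -> exists n, x ^+ n.+3 = x.
Proof.
move=> R_red.
have [i [d xid]] : exists i d, x ^+ i = x ^+ (i + d.+1).
  pose f (i : 'I_#|R|.+1) := x ^+ i.
  have /injectivePn[i [j ij fij]] : ~~ injectiveb f.
    by apply/injectiveP => /leq_card; rewrite card_ord ltnn.
  wlog lt_ij : i j ij fij / (i < j)%N.
    move=> H; have := ij; rewrite neq_ltn => /orP[] lt.
      exact: H ij fij lt.
    by apply: (H j i) => //; rewrite eq_sym.
  by exists i, (j - i).-1; rewrite prednK ?subn_gt0 // subnKC // ltnW.
(* The element x (1 - x^(d+1)) is nilpotent, since its power i + 1 contains the factor x^i (1 -
   x^(d+1)) = 0; so it vanishes. *)
have xd : x ^+ d.+2 = x.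
  have Hi : x ^+ i * (1 - x ^+ d.+1) = 0.
    by rewrite mulrBr mulr1 -exprD -xid subrr.
  have comm : GRing.comm x (1 - x ^+ d.+1).
    by apply: commrB; [exact: commr1 | exact/commrX/commr_refl].
  suff : x * (1 - x ^+ d.+1) = 0.
    by rewrite mulrBr mulr1 -exprS => /eqP; rewrite subr_eq0 => /eqP <-.
  apply: (reduced_nilpotent _ _ i.+1 R_red).
  rewrite exprMn_comm // [x ^+ i.+1]exprS [(1 - _) ^+ _]exprS mulrA.
  by rewrite -[x * _ * _]mulrA Hi mulr0 mul0r.
(* The exponent d + 2 may be only 2, so a second period d + 1 is added to reach at least 3. *)
exists (d + d)%N.
have -> : ((d + d).+3 = d.+2 + d.+1)%N by rewrite addSn addnS.
by rewrite exprD xd -exprS.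
Qed.

(** * Finite commutative rings and finite-dimensional algebras *)

Lemma Delta_ring_iso (p : nat) (R S : pzRingType) :
  ring_iso R S -> Delta_ring p S -> Delta_ring p R.
Proof.
move=> [f /bij_inj f_inj] Sp u [v [uv vu]]; apply: f_inj.
rewrite rmorphXn rmorph1 Sp //; exists (f v).
by rewrite -!rmorphM uv vu rmorph1.
Qed.

Lemma Delta_ring_ffun (p n : nat) (R : pzRingType) :
  Delta_ring p R -> Delta_ring p {ffun 'I_n -> R}.
Proof.
move=> Rp u [v [/ffunP uv /ffunP vu]]; apply/ffunP => i.
have uX m : (u ^+ m) i = u i ^+ m.
  by elim: m => [|m IH]; rewrite ?expr0 ?exprS !ffunE // IH.
rewrite uX ffunE Rp //; exists (v i).
by have := uv i; have := vu i; rewrite !ffunE.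
Qed.

Lemma Delta_ring_pair (p : nat) (R S : pzRingType) :
  Delta_ring p R -> Delta_ring p S -> Delta_ring p (R * S)%type.
Proof.
move=> Rp Sp [u v] [[u' v'] [[uu' vv'] [u'u v'v]]].
have X m : (u, v) ^+ m = (u ^+ m, v ^+ m) :> (R * S)%type.
  by elim: m => // m IH; rewrite !exprS IH.
by rewrite X Rp ?Sp //; [exists v' | exists u'].
Qed.

Lemma Delta_ring_exponent (p : nat) (R : pzRingType) :
  (forall x : R, x ^+ p.+1 = x) -> Delta_ring p R.
Proof.
move=> Rp u [v [uv _]].
by rewrite -uv -{2}(Rp u) exprSr -mulrA uv mulr1.
Qed.

Lemma Delta_ring_boolean (p : nat) (R : pzRingType) :
  (forall x : R, x ^+ 2 = x) -> Delta_ring p R.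
Proof.
move=> R2 u [v [uv _]].
suff -> : u = 1 by rewrite expr1n.
by rewrite -uv -{2}(R2 u) expr2 -mulrA uv mulr1.
Qed.

Lemma F2_boolean (x : 'F_2) : x ^+ 2 = x.
Proof. by rewrite -{2}[x]expf_card card_Fp. Qed.

Section FiniteCommutative.
Variables (p : nat) (p_prime : prime p) (p_odd : odd p).

Lemma product_Delta_ring (R : pzRingType) :
  (Mersenne_prime p /\ iso_F2_pow_Fq_pow p.+1 R) \/ iso_F2_pow R ->
  Delta_ring p R.
Proof.
have F2p := @Delta_ring_boolean p 'F_2 F2_boolean.
move=> [[_ [F [a [b [Fc]]]]]|[a]] => /Delta_ring_iso; apply.
  apply: Delta_ring_pair; apply: Delta_ring_ffun => //.
  by apply: Delta_ring_exponent => x; rewrite -Fc expf_card.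
exact: Delta_ring_ffun.
Qed.

Lemma finComPzRing_Delta (R : finComPzRingType) :
  Delta_ring p R <->
    (Mersenne_prime p /\ iso_F2_pow_Fq_pow p.+1 R) \/ iso_F2_pow R.
Proof.
split=> [Rp|]; last exact: product_Delta_ring.
have p_gt2 : (2 < p)%N by apply: odd_prime_gt2.
have [n pE] : exists n, p = n.+2 by exists p.-2; case: p p_gt2 => // -[].
have Rx (x : R) : x ^+ n.+3 = x.
  have [|m Hm] := finComPzRing_reduced_periodic R x.
    by move=> y; exact: Delta_ring_square0 p_odd Rp.
  by rewrite -pE; apply: Delta_ring_periodic Hm; rewrite // pE.
have Eid e : e \in primitive_idem R -> e * e = e by case/primitive_idemP.
have Eorth := @primitive_idem_orthogonal R.
have Ecard f :
    #|corner R n f| = 2 \/ Mersenne_prime p /\ #|corner R n f| = p.+1.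
  apply: finField_unit_exponent => // x x0; rewrite pE.
  exact: corner_unit_exponent.
have Efield e : e \in primitive_idem R ->
    exists f : field_idempotent R n, idem R n f = e.
  exact: primitive_idem_field.
have EF2 f : #|corner R n f| = 2 ->
    exists phi, corner_projection R 'F_2 (idem R n f) phi.
  by move=> f2; apply: corner_projection_field; rewrite f2 card_Fp.
(* The primitive idempotents are split by the order of eR: 2 in [E2], and p + 1 in its complement
   [E1]. *)
pose E2 := [set e in primitive_idem R | #|[set x : R | e * x == x]| == 2].
have E2proj e : e \in E2 -> exists phi, corner_projection R 'F_2 e phi.
  rewrite inE => /andP[/Efield[f <-]]; rewrite -card_corner => /eqP.
  exact: EF2.
have sub2 e : e \in E2 -> e \in primitive_idem R by rewrite inE => /andP[].
pose E1 := primitive_idem R :\: E2.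
have sub1 e : e \in E1 -> e \in primitive_idem R by rewrite inE => /andP[].
have [phi Pphi] := corner_projection_family R 'F_2 E2
  (fun e He => Eid e (sub2 e He)) (sub_in2 sub2 Eorth) E2proj.
have sumE : \sum_(e in E2) e + \sum_(e in E1) e = 1.
  rewrite -(sum_primitive_idem R) [RHS](big_setID E2) /=; congr (_ + _).
  by apply: eq_bigl => e; rewrite in_setI andb_idl // => /sub2.
(* Without a factor of order p + 1, nothing forces [p] to be Mersenne; this is the extra
   disjunct. *)
have [E10|[e0 e0E]] := set_0Vmem E1.
  right; exists #|E2|; apply: (corner_projection1 _ _ phi).
  by rewrite -sumE E10 big_set0 addr0.
left; have Ecard1 f : idem R n f \in E1 ->
    Mersenne_prime p /\ #|corner R n f| = p.+1.
  move=> fE; case: (Ecard f) => // f2; move: fE.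
  by rewrite in_setD inE -card_corner f2 eqxx andbT andNb.
have [f0 Hf0] := Efield _ (sub1 _ e0E).
have [Mp c0] : Mersenne_prime p /\ #|corner R n f0| = p.+1.
  by apply: Ecard1; rewrite Hf0.
(* One factor of order p + 1 serves as the model for all the others. *)
split=> //; exists (corner R n f0).
have [|psi Ppsi] := corner_projection_family R (corner R n f0) E1
  (fun e He => Eid e (sub1 e He)) (sub_in2 sub1 Eorth).
  move=> e eE; have [f Hf] := Efield _ (sub1 _ eE).
  rewrite -Hf; apply: corner_projection_field.
  by rewrite c0; apply: (Ecard1 f _).2; rewrite Hf.
exists #|E2|, #|E1|; split=> //.
apply: corner_projection_pair Pphi Ppsi => //.
rewrite mulr_suml big1 // => d dE; rewrite mulr_sumr big1 // => e eE.
apply: Eorth (sub2 _ dE) (sub1 _ eE) _.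
by apply: contraTneq dE => ->; move: eE; rewrite in_setD => /andP[].
Qed.

End FiniteCommutative.

(** * Finite types from exhaustive lists *)

Section Listed.
Variables (T : choiceType) (s : seq T) (T_s : forall x, x \in s).

(** An alias of [T] indexed by the proof of exhaustiveness, so that finiteness can be an instance;
    by conversion, results about the alias hold for [T]. *)
Definition listed of (forall x, x \in s) : predArgType := T.

HB.instance Definition _ := Choice.on (listed T_s).

Definition listed_pickle (x : listed T_s) : nat := index (x : T) s.
Definition listed_unpickle (i : nat) : option (listed T_s) :=
  nth None (map Some s) i.

Lemma listed_pickleK : pcancel listed_pickle listed_unpickle.
Proof.
move=> x; rewrite /listed_pickle /listed_unpickle.
by rewrite (nth_map (x : T)) ?index_mem ?T_s // nth_index.
Qed.

HB.instance Definition _ := isCountable.Build (listed T_s) listed_pickleK.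

Lemma listed_axiom : Finite.axiom (undup s : seq (listed T_s)).
Proof. by move=> x; rewrite count_uniq_mem ?undup_uniq // mem_undup T_s. Qed.

HB.instance Definition _ := isFinite.Build (listed T_s) listed_axiom.

End Listed.

HB.instance Definition _ (R : comPzRingType) (s : seq R)
    (R_s : forall x, x \in s) :=
  GRing.ComPzRing.on (listed R s R_s).
HB.instance Definition _ (K : fieldType) (s : seq K)
    (K_s : forall x, x \in s) :=
  GRing.Field.on (listed K s K_s).

(** Every element is a root of X^(n+2) - X, so there cannot be n + 3 distinct ones. *)
Lemma field_exponent_finite (k : fieldType) (n : nat) :
  (forall c : k, c != 0 -> c ^+ n.+1 = 1) ->
  exists s : seq k, forall c, c \in s.
Proof.
move=> kn; apply: boolp.contrapT => no_list.
have [s [s_uniq s_size]] : exists s : seq k, uniq s /\ size s = n.+3.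
  elim: n.+3 => [|m [s [s_uniq s_size]]]; first by exists [::].
  have [c cs] : exists c, c \notin s.
    apply: boolp.contrapT => H; apply: no_list; exists s => c.
    by apply/negPn/negP => cs; apply: H; exists c.
  by exists (c :: s); rewrite /= cs s_uniq s_size.
have size_P : size ('X^(n.+2) - 'X : {poly k}) = n.+3.
  by rewrite size_polyDl size_polyXn // size_polyN size_polyX.
have := max_poly_roots (p := 'X^(n.+2) - 'X) (rs := s).
rewrite -size_poly_eq0 size_P s_size ltnn s_uniq => H.
suff : false by []; apply: H => //; apply/allP => c _.
rewrite /root hornerD hornerN hornerXn hornerX subr_eq0.
by have [->|c0] := eqVneq c 0; rewrite ?expr0n // exprS kn // mulr1.
Qed.

Section FiniteDimensional.
Variables (p : nat) (p_prime : prime p) (p_odd : odd p).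

Lemma finite_dim_alg_Delta (k : fieldType) (R : comPzRingType)
    (iota : {rmorphism k -> R}) : finite_dim_alg iota ->
  Delta_ring p R <->
    (Mersenne_prime p /\ iso_F2_pow_Fq_pow p.+1 R) \/ iso_F2_pow R.
Proof.
move=> [n [e Re]]; split=> [Rp|]; last exact: product_Delta_ring.
suff [s R_s] : exists s : seq R, forall x, x \in s.
  exact: (finComPzRing_Delta p p_prime p_odd (listed R s R_s)).1 Rp.
(* In the zero ring, [iota] gives no information on k, which may be infinite. *)
have [R0|R0] := eqVneq (1 : R) 0.
  by exists [:: 0] => x; rewrite inE -[x]mulr1 R0 mulr0.
have [|s k_s] := field_exponent_finite k p.-1.
  move=> c c0; rewrite prednK ?prime_gt0 //.
  (* A nonzero c^p - 1 would be invertible in k yet map to 0 in R, so that 1 = 0 in R. *)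
  apply/eqP; rewrite -subr_eq0; apply: contraNT R0 => cp.
  have : iota (c ^+ p - 1) = 0.
    rewrite rmorphB rmorphXn rmorph1 Rp ?subrr //; exists (iota c^-1).
    by rewrite -!rmorphM mulfV // mulVf // rmorph1.
  by move=> i0; rewrite -(rmorph1 iota) -(mulfV cp) rmorphM i0 mul0r.
exists [seq \sum_i iota (c i) * e i | c : {ffun 'I_n -> listed k s k_s}] => x.
have [c [xc _]] := Re x; apply/mapP; exists c => //.
by rewrite mem_enum.
Qed.

End FiniteDimensional.

(** * Path algebras *)

Lemma sqrrD_comm2 (R : pzRingType) (x y : R) : 1 + 1 = 0 :> R ->
  GRing.comm x y -> (x + y) ^+ 2 = x ^+ 2 + y ^+ 2.
Proof.
move=> R2 xy; rewrite !expr2 mulrDl !mulrDr -xy addrA -[_ + _ + x * y]addrA.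
by rewrite addrr2 // addr0.
Qed.

Lemma exprD_comm_pow2 (R : pzRingType) (x y : R) m : 1 + 1 = 0 :> R ->
  GRing.comm x y -> (x + y) ^+ (2 ^ m) = x ^+ (2 ^ m) + y ^+ (2 ^ m).
Proof.
move=> R2 xy; elim: m => // m IH; rewrite expnSr !exprM IH sqrrD_comm2 //.
exact/commrX/commr_sym/commrX/commr_sym.
Qed.

Lemma expr_sum_pow2 (R : pzRingType) (I : Type) (r : seq I) (F : I -> R) m :
  1 + 1 = 0 :> R -> (forall i j, GRing.comm (F i) (F j)) ->
  (\sum_(i <- r) F i) ^+ (2 ^ m) = \sum_(i <- r) F i ^+ (2 ^ m).
Proof.
move=> R2 Fcomm; elim: r => [|i r IH].
  by rewrite !big_nil expr0n expn_eq0.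
rewrite !big_cons exprD_comm_pow2 // ?IH //.
by apply: commr_sum => j _; exact: Fcomm.
Qed.

Section BasisAlgebra.
Variables (A : pzRingType) (B : mulBasisType).

(** The structure map of the algebra. The identity need not be a basis element, so c is spread over
    all of [bids]. *)
Definition balg_scalar (c : A) : basis_alg A B :=
  \sum_(x <- bids : seq B) << c *g x >>.

Lemma balg_scalarMl (c a : A) (y : B) :
  balg_scalar c * (<< a *g y >> : basis_alg A B) = << c * a *g y >>.
Proof.
rewrite /balg_scalar mulr_suml.
under eq_bigr => x _ do rewrite [_ * _]balg_mulUU.
by rewrite omon_pmap bmul1x big_seq1.
Qed.

Lemma balg_scalarM (c d : A) :
  balg_scalar c * balg_scalar d = balg_scalar (c * d).
Proof.
rewrite {2}/balg_scalar mulr_sumr; apply: eq_bigr => x _.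
exact: balg_scalarMl.
Qed.

Lemma balg_scalar1 : balg_scalar 1 = 1.
Proof. by []. Qed.

Lemma balg_scalarX (c : A) n : balg_scalar c ^+ n = balg_scalar (c ^+ n).
Proof. by elim: n => [|n IH]; rewrite ?expr0 // !exprS IH balg_scalarM. Qed.

Lemma mcoeff_balg_scalar (c : A) (x : B) :
  mcoeff x (balg_scalar c) = c *+ count_mem x (bids : seq B).
Proof.
rewrite /balg_scalar raddf_sum /=; elim: (bids : seq B) => [|y r IH].
  by rewrite big_nil mulr0n.
by rewrite big_cons IH mcoeffU /= mulrnDr.
Qed.

Lemma Delta_ring_scalar (p : nat) (x : B) : count_mem x (bids : seq B) = 1%N ->
  Delta_ring p (basis_alg A B) -> Delta_ring p A.
Proof.
move=> x1 ABp u [v [uv vu]].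
have : balg_scalar u ^+ p = 1.
  by apply: ABp; exists (balg_scalar v); rewrite !balg_scalarM uv vu.
rewrite balg_scalarX -balg_scalar1 => /(congr1 (mcoeff x)).
by rewrite !mcoeff_balg_scalar x1.
Qed.

Lemma balg_char2 : 1 + 1 = 0 :> A -> 1 + 1 = 0 :> basis_alg A B.
Proof.
move=> A2; rewrite -balg_scalar1 /balg_scalar -big_split big1 //= => x _.
by rewrite -monalgUD A2 monalgU0.
Qed.

End BasisAlgebra.

Section PathAlgebra.
Variables (p : nat) (p_prime : prime p) (p_odd : odd p).
Variables (k : fieldType) (Q : finite_quiver).

Lemma count_trivial_path (v : vertex Q) :
  count_mem (trivial_path v) (bids : seq (qpath Q)) = 1%N.
Proof.
have tinj : injective (@trivial_path Q) by move=> u w [].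
rewrite -[bids]/(path_ids Q) /path_ids count_uniq_mem.
  by rewrite (mem_map tinj) mem_enum.
by rewrite map_inj_uniq // enum_uniq.
Qed.

Definition arrow_path (a : arrow Q) : qpath Q :=
  @QPath Q (source a, [:: a])
    (introT andP (conj (eqxx (source a)) (erefl true))).

(** By acyclicity an arrow is not a loop, so its square is a nonzero element's forbidden zero
    square. *)
Lemma Delta_trivial_quiver (v : vertex Q) : acyclic Q ->
  Delta_ring p (path_algebra k Q) -> trivial_quiver Q.
Proof.
move=> Q_acyclic kQp; apply: eq_card0 => a; apply/negP => _.
pose x : path_algebra k Q := << 1 *g arrow_path a >>.
have : x = 0.
  apply: Delta_ring_square0 p_odd kQp _; rewrite [LHS]balg_mulUU /=.
  have := path_mulP (arrow_path a) (arrow_path a); rewrite /bmul /=.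
  case: eqP => [e _|_ -> //].
  by have := Q_acyclic (arrow_path a) (esym e).
by move/eqP; rewrite monalgU_eq0 oner_eq0.
Qed.

(** Without arrows, the only paths are the e_v, which are orthogonal idempotents: multiplication is
    componentwise, as in a power of k. *)
Lemma trivial_quiver_mcoeffM (z : qpath Q) (g h : path_algebra k Q) :
  trivial_quiver Q -> mcoeff z (g * h) = mcoeff z g * mcoeff z h.
Proof.
move=> Q0.
have pathE (x : qpath Q) : x = trivial_path (path_start x).
  apply: qpath_eq => //; case: x => [[v [|a s]] w] //.
  by have := card0_eq Q0 a.
have endE (x : qpath Q) : path_end x = path_start x by rewrite [x]pathE.
have eqE (x y : qpath Q) : (x == y) = (path_start y == path_start x).
  by apply/eqP/eqP => [->|e] //; rewrite [x]pathE [y]pathE e.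
have bmulE (x y : qpath Q) : bmul x y = if x == y then Some x else None.
  rewrite -[bmul x y]/(path_mul x y) eqE; have := path_mulP x y; rewrite endE.
  case: eqP => // e [w [-> s _ _]].
  by congr Some; rewrite [w]pathE [x]pathE s e.
rewrite [g * h]balg_mulEl {3}[g]monalgE {2}[h]monalgE !raddf_sum /= mulr_suml.
apply: eq_bigr => x _; rewrite balg_mulEr raddf_sum mulr_sumr /=.
apply: eq_bigr => y _; rewrite balg_mulUU bmulE !mcoeffU.
case: (eqVneq x y) => [<-|xy] /=; first rewrite mcoeffU.
  by case: (x == z); rewrite ?mulr1n // !mulr0n mulr0.
rewrite mcoeff0; case: (eqVneq x z) => [<-|_]; last by rewrite mul0r.
by rewrite eq_sym (negPf xy) mulr0.
Qed.

Lemma trivial_quiver_periodic q : trivial_quiver Q ->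
  (forall c : k, c ^+ q.+1 = c) -> forall x : path_algebra k Q, x ^+ q.+1 = x.
Proof.
move=> Q0 kq x; apply/malgP => z; rewrite -[RHS]kq.
elim: q {kq} => [|q IH] //.
by rewrite exprS trivial_quiver_mcoeffM // IH -exprS.
Qed.

Lemma is_field_of_order_expr q : is_field_of_order q k ->
  forall c : k, c ^+ q = c.
Proof.
move=> [F [<- [f /bij_inj f_inj]]] c.
by apply: f_inj; rewrite rmorphXn; exact: expf_card.
Qed.

Lemma Delta_field_order : Delta_ring p k ->
  is_field_of_order 2 k \/ Mersenne_prime p /\ is_field_of_order p.+1 k.
Proof.
move=> kp; have kX (c : k) : c != 0 -> c ^+ p = 1.
  by move=> c0; apply: kp; exists c^-1; rewrite mulfV ?mulVf.
have [|s k_s] := field_exponent_finite k p.-1.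
  by move=> c; rewrite prednK ?prime_gt0 //; exact: kX.
pose K : finFieldType := listed k s k_s.
have kK : ring_iso k K by exists (idfun : {rmorphism k -> k}); exists id.
have [c2|[Mp cp]] := finField_unit_exponent K p p_prime p_odd kX.
  by left; exists K.
by right; split=> //; exists K.
Qed.

Lemma path_algebra_Delta : acyclic Q ->
  Delta_ring p (path_algebra k Q) <->
    ((is_field_of_order 2 k \/ (Mersenne_prime p /\ is_field_of_order p.+1 k))
       /\ trivial_quiver Q)
    \/ #|vertex Q| = 0%N.
Proof.
move=> Q_acyclic; split=> [kQp|[[kF Q0]|Q0]].
- have [v _|] := pickP (vertex Q); last by right; exact: eq_card0.
  left; split; last exact: Delta_trivial_quiver v Q_acyclic kQp.
  exact/Delta_field_order/(Delta_ring_scalar _ _ _ _ (count_trivial_path v)).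
- case: kF => [/is_field_of_order_expr k2|[_ /is_field_of_order_expr kp]].
    exact/Delta_ring_boolean/trivial_quiver_periodic.
  exact/Delta_ring_exponent/trivial_quiver_periodic.
- move=> u _; rewrite -[LHS]mul1r -[RHS]mul1r.
  suff -> : 1 = 0 :> path_algebra k Q by rewrite !mul0r.
  rewrite -balg_scalar1 /balg_scalar -[bids]/(path_ids Q) /path_ids.
  by rewrite (size0nil (s := enum _)) ?big_nil // -cardE.
Qed.
End PathAlgebra.

(** * Group rings *)

(** Fermat's little theorem with an explicit quotient, ready for multiples in a group killed by
    [p]. *)
Lemma expn_pred_prime (p n : nat) : prime p -> ~~ (p %| n)%N ->
  exists q, (n ^ p.-1 = q * p + 1)%N.
Proof.
move=> p_prime pn; exists (n ^ p.-1 %/ p)%N; rewrite {1}(divn_eq (n ^ p.-1) p).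
congr (_ + _)%N; rewrite -(totient_prime p_prime) Euler_exp_totient.
  by rewrite modn_small ?prime_gt1.
by rewrite coprime_sym prime_coprime.
Qed.

Lemma mulrn_eq0_prime (p n : nat) (G : zmodType) (g : G) : prime p ->
  g *+ p = 0 -> g != 0 -> g *+ n = 0 -> (p %| n)%N.
Proof.
move=> p_prime gp g0 gn; apply: contraNT g0 => pn.
have [q Hq] := expn_pred_prime p n p_prime pn.
have p1 : (0 < p.-1)%N by rewrite -subn1 subn_gt0 prime_gt1.
have : g *+ (n ^ p.-1) = 0 by rewrite -(prednK p1) expnS mulrnA gn mul0rn.
by rewrite Hq mulrnDr mulnC mulrnA gp mul0rn add0r mulr1n => ->.
Qed.

Section GroupRing.
Variable (A : pzRingType) (G : zmodType).
Notation AG := (group_ring A G).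

Definition gr_mono (a : A) (g : G) : AG := << a *g (g : group_basis G) >>.

Lemma gr_monoM (a b : A) (g h : G) :
  gr_mono a g * gr_mono b h = gr_mono (a * b) (g + h).
Proof. exact: balg_mulUU. Qed.

Lemma gr_mono1 : gr_mono 1 0 = 1.
Proof. by rewrite -(balg_scalar1 A (group_basis G)) /balg_scalar big_seq1. Qed.

Lemma gr_monoX (a : A) (g : G) n : gr_mono a g ^+ n = gr_mono (a ^+ n) (g *+ n).
Proof.
elim: n => [|n IH]; first by rewrite !expr0 mulr0n gr_mono1.
by rewrite !exprS IH gr_monoM mulrS.
Qed.

Lemma mcoeff_gr_mono (a : A) (g h : G) :
  mcoeff (h : group_basis G) (gr_mono a g) = a *+ (g == h).
Proof. exact: mcoeffU. Qed.

Lemma gr_monoE (x : AG) :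
  x = \sum_(g <- msupp (x : {malg A[group_basis G]}))
        gr_mono (mcoeff g (x : {malg A[group_basis G]})) g.
Proof. exact: monalgE. Qed.

Lemma count_group_one :
  count_mem (0 : group_basis G) (bids : seq (group_basis G)) = 1%N.
Proof. by rewrite /bids /= eqxx. Qed.

End GroupRing.

Lemma Zmod2_char2 : 1 + 1 = 0 :> Zmod 2.
Proof. exact: val_inj. Qed.

Lemma Zmod2_expr (a : Zmod 2) n : a ^+ n.+1 = a.
Proof.
elim: n => // n IH; rewrite exprS IH.
by apply: val_inj; case: a {IH} => [[|[|//]]].
Qed.

Lemma Zmod_char2 n : (0 < n)%N -> 1 + 1 = 0 :> Zmod n -> n = 1%N \/ n = 2.
Proof. by case: n => [|[|[|n]]] // _; [left|right]. Qed.

(** Iterated Frobenius acts on each monomial separately, fixing its coefficient in F_2 and its group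
    element. *)
Lemma group_ring_pow2 (G : zmodType) m : (forall g : G, g *+ (2 ^ m) = g) ->
  forall x : group_ring (Zmod 2) G, x ^+ (2 ^ m) = x.
Proof.
move=> Gm x; have R2 := balg_char2 _ (group_basis G) Zmod2_char2.
rewrite {1}[x]gr_monoE expr_sum_pow2 //; last first.
  by move=> g h; rewrite /GRing.comm !gr_monoM mulrC addrC.
rewrite [RHS]gr_monoE; apply: eq_bigr => g _; rewrite gr_monoX Gm.
by rewrite -(prednK (expn_gt0 2 m : (0 < 2 ^ m)%N)) Zmod2_expr.
Qed.

Section GroupRingDelta.
Variables (p : nat) (p_prime : prime p) (p_odd : odd p) (G : zmodType).
Notation F2G := (group_ring (Zmod 2) G).

Lemma Delta_group_exponent : Delta_ring p F2G -> forall g : G, g *+ p = 0.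
Proof.
move=> Rp g; have : gr_mono (Zmod 2) G 1 g ^+ p = 1.
  apply: Rp; exists (gr_mono _ G 1 (- g)).
  by rewrite !gr_monoM mulr1 addrN addNr gr_mono1.
rewrite gr_monoX expr1n -gr_mono1 => /(congr1 (mcoeff (0 : group_basis G))).
by rewrite !mcoeff_gr_mono eqxx; case: eqP.
Qed.

(* Write [p + 1 = 2^k m] with [m] odd and [h = g *+ 2^k]. Then [(1 + h)^m]    *)
(* is [1 + g]; the coefficient of [h] is [m], hence nonzero in F_2, on the    *)
(* left, and 0 on the right unless [m = 1].                                   *)
Lemma Delta_group_Mersenne (g : G) :
  g != 0 -> Delta_ring p F2G -> Mersenne_prime p.
Proof.
move=> g0 Rp; split=> //; have Gp := Delta_group_exponent Rp.
have R2 := balg_char2 _ (group_basis G) Zmod2_char2.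
have p_gt2 := odd_prime_gt2 p_odd p_prime.
have divp n : g *+ n = 0 -> (p %| n)%N.
  exact: mulrn_eq0_prime p_prime (Gp g) g0.
pose X h := gr_mono (Zmod 2) G 1 h.
have X1 h n : (1 + X h) ^+ (2 ^ n) = 1 + X (h *+ 2 ^ n).
  rewrite exprD_comm_pow2 ?expr1n ?gr_monoX ?expr1n //.
  exact/commr_sym/commr1.
(* By Fermat, 2^(p-1) is 1 modulo p, so Frobenius makes 1 + g periodic with exponent 2^(p-1), which
   is at least 4 and can be written as n + 3. *)
have per : (1 + X g) ^+ p.+1 = 1 + X g.
  have [q Hq] : exists q, (2 ^ p.-1 = q * p + 1)%N.
    by apply: expn_pred_prime; rewrite // dvdn_prime2 // neq_ltn p_gt2 orbT.
  apply: (Delta_ring_periodic _ (2 ^ p.-1 - 3)) => //; first exact: prime_gt0.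
  rewrite -addn3 subnK.
    by rewrite X1 Hq mulrnDr mulnC mulrnA Gp mul0rn add0r.
  apply: leq_trans (leq_pexp2l _ (_ : 2 <= _)%N) => //.
  by case: p p_gt2 => [|[|[]]].
have [m] := pfactor_coprime (isT : prime 2) (ltn0Sn p).
set k := logn 2 p.+1; rewrite coprime2n => m_odd pE.
have k_gt0 : (0 < k)%N by rewrite logn_gt0 mem_primes /= dvdn2 /= p_odd.
case: (ltnP 1 m) => [m_gt1|m_le1]; last first.
  exists k; have m1 : m = 1%N by case: m m_odd m_le1 {pE} => [|[]].
  by rewrite -[p]/(p.+1.-1) pE m1 mul1n subn1.
exfalso.
have k2_gt1 : (1 < 2 ^ k)%N by rewrite -{1}(expn0 2) ltn_exp2l.
(* With m > 1, both 2^k and m are at most p, so [fix1] can tell apart the multiples of g and of h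
   that occur below. *)
have k2_lt : (2 ^ k < p)%N.
  rewrite -ltnS pE; apply: leq_trans (leq_mul m_gt1 (leqnn (2 ^ k))).
  by rewrite mul2n -addnn -addn2 leq_add2l.
have m_lt : (m <= p)%N.
  by rewrite -ltnS pE -[X in (X < _)%N]muln1 ltn_pmul2l // ltnW.
have := per; rewrite {1}pE mulnC exprM X1; set h := g *+ 2 ^ k.
rewrite exprDn_comm; last exact/commr_sym/commr1.
move=> /(congr1 (mcoeff (h : group_basis G))); rewrite mcoeffD raddf_sum /=.
have h0 : h != 0 by apply/eqP => /divp; rewrite gtnNdvd // ltnW.
have coefX a n i :
    mcoeff (h : group_basis G) ((1 ^+ n * X a ^+ i) *+ 'C(m, i)) =
    (a *+ i == h)%:R *+ 'C(m, i).
  by rewrite mcoeffMn expr1n mul1r gr_monoX expr1n mcoeff_gr_mono.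
under eq_bigr do rewrite coefX.
have fix1 (a : G) i : a != 0 -> (i <= p)%N -> a *+ i = a -> i = 1%N.
  case: i => [|[|i]] // a0.
    by rewrite mulr0n => _ e; rewrite -e eqxx in a0.
  rewrite mulrS -{3}[a]addr0 => ip /addrI.
  move=> /(mulrn_eq0_prime _ _ _ _ p_prime (Gp a) a0); by rewrite gtnNdvd.
have m1 : (1 < m.+1)%N by apply: ltnW.
(* In the expansion of (1 + h)^m, only the term i = 1 contributes to the coefficient of h, because i
   h = h with i at most p forces i = 1. *)
rewrite (bigD1 (Ordinal m1)) //= bin1 mulr1n eqxx big1 => [|i i1].
  rewrite addr0 -gr_mono1 !mcoeff_gr_mono eq_sym (negPf h0) mulr0n add0r.
  rewrite eq_sym; case: eqP => [/(fix1 _ _ g0 (ltnW k2_lt)) e|_].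
    by rewrite e in k2_gt1.
  by rewrite mulr0n (mulrn_odd _ _ _ Zmod2_char2) m_odd.
case: eqP => [/(fix1 _ _ h0 _) e|_]; last by rewrite mul0rn.
case/eqP: i1; apply: val_inj; apply: e.
by apply: leq_trans m_lt; rewrite -ltnS.
Qed.

Lemma elementary_abelian_exponent : elementary_abelian p G ->
  forall g : G, g *+ p = 0.
Proof.
move=> [I [f [f' _ f'K]]] g; rewrite -[g]f'K -raddfMn.
suff -> : f' g *+ p = 0 by rewrite raddf0.
apply/malgP => i; rewrite mcoeffMn mcoeff0 -mulr_natr.
by rewrite -{2}(Zp_cast (prime_gt1 p_prime)) char_Zp ?mulr0 ?prime_gt1.
Qed.

(** * Groups of exponent p as vector spaces over F_p *)

Section Basis.
Hypothesis Gp : forall g : G, g *+ p = 0.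

Lemma mulrn_Zp (g : G) (a b : 'Z_p) : g *+ (a + b)%R = g *+ a + g *+ b.
Proof.
rewrite /=; move: (nat_of_ord a) (nat_of_ord b) => x y.
rewrite (Zp_cast (prime_gt1 p_prime)) -mulrnDr {2}(divn_eq (x + y) p).
by rewrite mulrnDr mulnC mulrnA Gp mul0rn add0r.
Qed.

Section Span.
Variables (I : choiceType) (v : I -> G).

(** Coefficients act through their representatives in [nat]; additivity in m holds because pG =
    0. *)
Definition lin_comb (m : {malg 'Z_p[I]}) : G :=
  \sum_(i <- msupp m) v i *+ mcoeff i m.

Lemma lin_combE (d : {fset I}) m : (msupp m `<=` d)%fset ->
  lin_comb m = \sum_(i <- d) v i *+ mcoeff i m.
Proof.
move=> md; rewrite /lin_comb (big_fset_incl _ md) // => i _ /mcoeff_outdom ->.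
by rewrite mulr0n.
Qed.

Lemma lin_comb0 : lin_comb 0 = 0.
Proof. by rewrite /lin_comb msupp0 big_seq_fset0. Qed.

Lemma lin_combD : {morph lin_comb : m1 m2 / m1 + m2}.
Proof.
move=> m1 m2; pose d := (msupp m1 `|` msupp m2)%fset.
rewrite (lin_combE d (m1 + m2)) ?msuppD_le // (lin_combE d m1) ?fsubsetUl //.
rewrite (lin_combE d m2) ?fsubsetUr // -big_split; apply: eq_bigr => i _.
by rewrite mcoeffD mulrn_Zp.
Qed.

Lemma lin_combN : {morph lin_comb : m / - m}.
Proof.
by move=> m; apply: (addrI (lin_comb m)); rewrite -lin_combD !subrr lin_comb0.
Qed.

Lemma lin_combMn n : {morph lin_comb : m / m *+ n}.
Proof.
move=> m; elim: n => [|n IH]; rewrite ?mulr0n ?lin_comb0 //.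
by rewrite !mulrS lin_combD IH.
Qed.

Lemma lin_combU i a : lin_comb << a *g i >> = v i *+ a.
Proof. by rewrite (lin_combE _ _ msuppU_le) big_seq_fset1 mcoeffUU. Qed.

Definition lin_comb_sum := big_morph lin_comb lin_combD lin_comb0.

End Span.

Definition supported (B : classical_sets.set G) (m : {malg 'Z_p[G]}) : Prop :=
  forall x, mcoeff x m != 0 -> B x.

Definition independent (B : classical_sets.set G) : Prop :=
  forall m, supported B m -> lin_comb G id m = 0 -> m = 0.

(** If g were outside the span, adding it to B would keep independence: in a relation, a nonzero
    coefficient of g could be inverted to express g through B. *)
Lemma maximal_independent_span (B : classical_sets.set G) : independent B ->
  (forall C, classical_sets.proper B C -> ~ independent C) ->
  forall g, exists2 m, supported B m & lin_comb G id m = g.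
Proof.
move=> B_ind B_max g; apply: boolp.contrapT => no_m.
pose C x := B x \/ x = g; apply: (B_max C).
  split=> [x Bx|]; first by left.
  move=> CB; apply: no_m; exists << 1 *g g >>; last by rewrite lin_combU mulr1n.
  move=> x; rewrite mcoeffU; case: (g =P x) => [<- _|]; last by rewrite eqxx.
  by apply: CB; right.
move=> m mC m0; pose c := mcoeff g m; pose m' := m - << c *g g >>.
have m'B : supported B m'.
  move=> x; rewrite mcoeffB mcoeffU; have [<-|gx] := eqVneq g x.
    by rewrite mulr1n subrr eqxx.
  by rewrite mulr0n subr0 => /mC[|xg] //; rewrite xg eqxx in gx.
have [c0|c0] := eqVneq c 0.
  by apply: B_ind m0; move: m'B; rewrite /m' c0 monalgU0 subr0.
(* The factor c^(p-2) is the inverse of c modulo p. *)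
case: no_m; exists ((- m') *+ c ^ p.-2).
  move=> x; rewrite mcoeffMn mcoeffN => x0; apply: m'B.
  by apply: contraNneq x0 => ->; rewrite oppr0 mul0rn.
have -> : lin_comb G id ((- m') *+ c ^ p.-2) = g *+ c *+ c ^ p.-2.
  rewrite lin_combMn; congr (_ *+ _); rewrite -(lin_combU G id).
  by rewrite /m' opprB lin_combD lin_combN m0 subr0.
have pc : ~~ (p %| c)%N.
  apply: contra c0 => /dvdnP[[|q] cq]; first by apply/eqP/val_inj.
  have := ltn_ord c; rewrite {2}(Zp_cast (prime_gt1 p_prime)) cq.
  by rewrite mulSn ltnNge leq_addr.
have [q Hq] := expn_pred_prime p c p_prime pc.
have p1 : (0 < p.-1)%N by rewrite -subn1 subn_gt0 prime_gt1.
move: (nat_of_ord c) Hq => a Hq; rewrite -mulrnA -expnS (prednK p1).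
by rewrite Hq mulrnDr mulnC mulrnA Gp mul0rn add0r.
Qed.

Lemma exponent_elementary_abelian : elementary_abelian p G.
Proof.
have [B [B_ind B_max]] : exists B, independent B /\
    forall C, classical_sets.proper B C -> ~ independent C.
  apply: classical_sets.Zorn_bigcup => F F_ind F_tot m mF m0.
  (* A finite support covered by a chain lies in one of its members; the empty support is kept apart
     because the chain may be empty. *)
  have cover (s : seq G) : (forall x, x \in s -> exists2 X, F X & X x) ->
      s = [::] \/ exists2 X, F X & forall x, x \in s -> X x.
    elim: s => [|x s IH] sF; [by left | right].
    have [X FX Xx] := sF x (mem_head x s).
    have sF' y : y \in s -> exists2 X, F X & X y.
      by move=> ys; apply: sF; rewrite inE ys orbT.
    case: (IH sF') => [s0|[Y FY Ys]].
    - by exists X => // y; rewrite s0 inE => /eqP ->.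
    - have [XY|YX] := F_tot X Y FX FY.
        exists Y => // y; rewrite inE => /predU1P[->|/Ys //]; exact: XY.
      by exists X => // y; rewrite inE => /predU1P[->|/Ys /YX].
  have mcover x : x \in (msupp m : seq G) -> exists2 X, F X & X x.
    by rewrite -[_ \in _]/(x \in msupp m) -mcoeff_neq0 => /mF.
  case: (cover (msupp m) mcover) => [s0|[X FX Xm]].
  - by rewrite [m]monalgE s0 big_nil.
  - by apply: (F_ind X FX) => // x; rewrite mcoeff_neq0 => /Xm.
have B_span := maximal_independent_span B B_ind B_max.
pose I : choiceType := {x : G | boolp.asbool (B x)}.
pose f := lin_comb I val.
have f_add : nmod_morphism f by split; [exact: lin_comb0 | exact: lin_combD].
pose fa := GRing.isNmodMorphism.Build _ _ f f_add.
exists I, (HB.pack_for {additive {malg 'Z_p[I]} -> G} f fa).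
have f_ker m : f m = 0 -> m = 0.
  (* The combination m is pushed forward from the subtype I to G, where independence is stated. *)
  pose m' : {malg 'Z_p[G]} := \sum_(i <- msupp m) << mcoeff i m *g val i >>.
  have m'E (i : I) : mcoeff (val i) m' = mcoeff i m.
    rewrite [m in RHS]monalgE !raddf_sum; apply: eq_bigr => j _ /=.
    by rewrite !mcoeffU -val_eqE.
  have <- : lin_comb G id m' = f m.
    by rewrite lin_comb_sum; apply: eq_bigr => i _; rewrite lin_combU.
  move/B_ind => m'0; apply/malgP => i; rewrite -m'E m'0 ?mcoeff0 // => x.
  have [//|Bx] := boolp.pselect (B x).
  rewrite raddf_sum /= big1 ?eqxx // => j _; rewrite mcoeffU.
  case: eqP => // jx; case: Bx.
  by rewrite -jx; apply/boolp.asboolP; exact: valP j.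
have f_surj g : exists m, f m == g.
  have [m mB <-] := B_span g.
  (* The default 0 is never reached, as m is supported in B. *)
  exists (\sum_(x <- msupp m)
            if insub x is Some i then << mcoeff x m *g i >> else 0).
  apply/eqP; rewrite /f lin_comb_sum /lin_comb; apply: eq_big_seq => x.
  rewrite -mcoeff_neq0 => /mB/boolp.asboolP Bx.
  by rewrite insubT -/(lin_comb _ _ _) lin_combU.
exists (fun g => xchoose (f_surj g)) => [m|g].
  2: exact/eqP/(xchooseP (f_surj g)).
apply/eqP; rewrite -subr_eq0; apply/eqP/f_ker; rewrite /f lin_combD lin_combN.
by rewrite -/f (eqP (xchooseP (f_surj (f m)))) subrr.
Qed.

End Basis.

(** A nonzero g is what forces [p] to be Mersenne; for trivial G the ring is Boolean and its only
    unit is 1. Conversely, when p + 1 = 2^m, Frobenius gives x^(p+1) = x. *)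
Lemma group_ring2_Delta : Delta_ring p F2G <->
  (elementary_abelian p G /\ Mersenne_prime p) \/ forall g : G, g = 0.
Proof.
split=> [Rp|[[Gel [_ [m pE]]]|G0]].
- case: (boolp.pselect (forall g : G, g = 0)) => [G0|]; first by right.
  move=> /boolp.existsNP[g /eqP g0].
  left; split; last exact: Delta_group_Mersenne g0 Rp.
  exact/exponent_elementary_abelian/Delta_group_exponent.
- apply: Delta_ring_exponent => x.
  have -> : p.+1 = (2 ^ m)%N by rewrite pE subn1 prednK ?expn_gt0.
  apply: group_ring_pow2 => g.
  have -> : (2 ^ m)%N = p.+1 by rewrite pE subn1 prednK ?expn_gt0.
  by rewrite mulrS elementary_abelian_exponent ?addr0.
- apply: Delta_ring_boolean; apply: (group_ring_pow2 G 1) => g.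
  by rewrite (G0 g) mul0rn.
Qed.

Lemma group_ring_Delta n : (0 < n)%N ->
  Delta_ring p (group_ring (Zmod n) G) <->
    (n = 2%N /\ elementary_abelian p G /\ Mersenne_prime p)
    \/ (n = 2%N /\ forall g : G, g = 0)
    \/ n = 1%N.
Proof.
move=> n_gt0; split=> [Rp|[[-> H]|[[-> H]|->]]].
- have := Delta_ring_scalar _ _ _ _ (count_group_one G) Rp.
  move=> /(Delta_ring_char2 _ _ p_odd)/(Zmod_char2 _ n_gt0)[->|n2].
    by right; right.
  rewrite n2 in Rp *.
  by have [[E M]|G0] := group_ring2_Delta.1 Rp; [left | right; left].
- by apply/group_ring2_Delta; left.
- by apply/group_ring2_Delta; right.
(* For n = 1 the coefficients lie in a one-element type, so all elements are equal. *)
- move=> u _; apply/malgP => g; apply: val_inj.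
  by case: (mcoeff _ _) => [[]]; case: (mcoeff _ _) => [[]].
Qed.
End GroupRingDelta.

(* The last disjuncts record the degenerate cases, where the unit group is    *)
(* trivial (so that p is arbitrary) or the ring is zero.                      *)
Theorem theorem1p3 (p : nat) (p_prime : prime p) (p_odd : odd p) :
  [/\ forall (k : fieldType) (R : comPzRingType) (iota : {rmorphism k -> R}),
        finite_dim_alg iota ->
        (Delta_ring p R <->
           (Mersenne_prime p /\ iso_F2_pow_Fq_pow p.+1 R) \/ iso_F2_pow R),
      forall R : finComPzRingType,
        Delta_ring p R <->
           (Mersenne_prime p /\ iso_F2_pow_Fq_pow p.+1 R) \/ iso_F2_pow R,
      forall (n : nat) (G : zmodType), (0 < n)%N ->
        (Delta_ring p (group_ring (Zmod n) G) <->
           (n = 2%N /\ elementary_abelian p G /\ Mersenne_prime p)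
           \/ (n = 2%N /\ forall g : G, g = 0)
           \/ n = 1%N)
    & forall (k : fieldType) (Q : finite_quiver), acyclic Q ->
        (Delta_ring p (path_algebra k Q) <->
           ((is_field_of_order 2 k \/
               (Mersenne_prime p /\ is_field_of_order p.+1 k))
              /\ trivial_quiver Q)
           \/ #|vertex Q| = 0%N)].
Proof.
split=> [k R iota|R|n G|k Q].
- exact: finite_dim_alg_Delta.
- exact: finComPzRing_Delta.
- exact: group_ring_Delta.
- exact: path_algebra_Delta.
Qed.
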